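(* (a) Let $\mathfrak{g}$ be one of the nilpotent Lie algebras $A_{n-1}^+$, $B_n^+$, $D_n^+$, let $\Phi^+$ be the corresponding set of positive roots, and let $\alpha=\epsilon_i-\epsilon_j\in\Phi^+$ with $1\le i<j\le n$. Then the elementary coadjoint orbit $O_\alpha(1)$ consists of all $f\in\mathfrak{g}^*$ such that, for every $\beta\in R(\alpha)$, $$f(e_\beta)=\begin{cases}1 & \text{if }\beta=\alpha,\\ f(e_{\epsilon_i-\epsilon_s})\,f(e_{\epsilon_r-\epsilon_j}) & \text{if }\beta=\epsilon_r-\epsilon_s \text{ with } i<r<s<j,\\ 0 & \text{otherwise},\end{cases}$$ while the values $f(e_\beta)$ for $\beta\in S(\alpha)$ are arbitrary. (b) Let $\mathfrak{g}=B_n^+$ and $1\le i\le n$. Then the elementary coadjoint orbit $O_{\epsilon_i}(1)$ consists of all $f\in\mathfrak{g}^*$ such that, for every $\beta\in R(\epsilon_i)$, $$f(e_\beta)=\begin{cases}1 & \text{if }\beta=\epsilon_i,\\ f(e_{\epsilon_i-\epsilon_s})\,f(e_{\epsilon_r}) & \text{if }\beta=\epsilon_r-\epsilon_s\text{ with } i<r<s\le n,\\ 0 & \text{otherwise},\end{cases}$$ while the values $f(e_\beta)$ for $\beta\in S(\epsilon_i)$ are arbitrary.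
   Context: All Lie algebras are over $\mathbb{C}$; $n$ is a positive integer; $E_{ab}$ denotes the matrix unit with $1$ in position $(a,b)$ and $0$ elsewhere. The symbols $\epsilon_1,\dots,\epsilon_n$ are linearly independent (the usual coordinate functionals on the diagonal Cartan subalgebra). Positive roots: $\Phi^+(A_{n-1})=\{\epsilon_i-\epsilon_j: 1\le i<j\le n\}$; $\Phi^+(B_n)=\{\epsilon_i\pm\epsilon_j:1\le i<j\le n\}\cup\{\epsilon_i:1\le i\le n\}$; $\Phi^+(D_n)=\{\epsilon_i\pm\epsilon_j:1\le i<j\le n\}$. $A_{n-1}^+$ is the Lie algebra of strictly upper triangular $n\times n$ matrices, with basis $e_{\epsilon_i-\epsilon_j}=E_{ij}$ ($i<j$). $B_n^+$ is the Lie algebra of strictly upper triangular $(2n+1)\times(2n+1)$ matrices that are antisymmetric about the antidiagonal, with basis $e_{\epsilon_i-\epsilon_j}=E_{ij}-E_{2n+2-j,2n+2-i}$ ($i<j\le n$), $e_{\epsilon_i}=E_{i,n+1}-E_{n+1,2n+2-i}$ ($i\le n$), $e_{\epsilon_i+\epsilon_j}=E_{i,2n+2-j}-E_{j,2n+2-i}$ ($i<j\le n$). $D_n^+$ is the Lie algebra of strictly upper triangular $2n\times 2n$ matrices that are antisymmetric about the antidiagonal, with basis $e_{\epsilon_i-\epsilon_j}=E_{ij}-E_{2n+1-j,2n+1-i}$, $e_{\epsilon_i+\epsilon_j}=E_{i,2n+1-j}-E_{j,2n+1-i}$ ($i<j\le n$). For $\alpha\in\Phi^+$, the set $S(\alpha)$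 of $\alpha$-singular roots is the union of all pairs $\{\beta,\gamma\}\subset\Phi^+$ with $\beta+\gamma=\alpha$, and the set of $\alpha$-regular roots is $R(\alpha)=\Phi^+\setminus S(\alpha)$. The group $G=\exp(\mathfrak{g})$ (matrix exponentials) acts on the dual space $\mathfrak{g}^*$ by the coadjoint action $(g.f)(x)=f(g^{-1}xg)$. Let $\{e_\alpha^*\}_{\alpha\in\Phi^+}$ be the basis of $\mathfrak{g}^*$ dual to $\{e_\alpha\}_{\alpha\in\Phi^+}$. For $c\in\mathbb{C}\setminus\{0\}$, the elementary orbit $O_\alpha(c)$ is the $G$-orbit of $c\,e_\alpha^*$ in $\mathfrak{g}^*$. *)

(* Defs.v *)
From HB Require Import structures.
From mathcomp Require Import all_boot all_order all_algebra.
From mathcomp Require Import complex.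
From mathcomp Require Import all_classical all_reals all_analysis.

Set Implicit Arguments.
Unset Strict Implicit.
Unset Printing Implicit Defensive.

Import Order.TTheory GRing.Theory Num.Theory.
Import numFieldNormedType.Exports.

Local Open Scope classical_set_scope.
Local Open Scope ring_scope.

(* The three families A_{n-1}^+, B_n^+, D_n^+; [n] is always the number of
   coordinate functionals, so [TA] with parameter [n] is A_{n-1}^+.
   All indices are 0-based. *)
Variant lie_type := TA | TB | TD.

Definition mxdim (t : lie_type) (n : nat) : nat :=
  match t with TA => n | TB => n.*2.+1 | TD => n.*2 end.

Definition is_TA (t : lie_type) : bool := if t is TA then true else false.

Lemma leq_mxdim t n : (n <= mxdim t n)%N.
Proof. by case: t => //=; rewrite -addnn ?leqW ?leq_addr. Qed.

Definition eps n (i : 'I_n) : 'rV[int]_n := delta_mx 0 i.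

Definition lt_pairs n : seq ('I_n * 'I_n) :=
  [seq p : 'I_n * 'I_n <- enum predT | (p.1 < p.2)%N].

Definition pos_roots (t : lie_type) (n : nat) : seq 'rV[int]_n :=
  [seq eps p.1 - eps p.2 | p <- lt_pairs n]
  ++ (if is_TA t then [::] else [seq eps p.1 + eps p.2 | p <- lt_pairs n])
  ++ (if t is TB then [seq eps i | i <- enum 'I_n] else [::]).

Definition singular_roots t n (a : 'rV[int]_n) : seq 'rV[int]_n :=
  [seq b <- pos_roots t n | has (fun c => b + c == a) (pos_roots t n)].

Definition regular_roots t n (a : 'rV[int]_n) : seq 'rV[int]_n :=
  [seq b <- pos_roots t n | b \notin singular_roots t a].

Section LieAlgebra.
Variables (K : fieldType) (t : lie_type) (n : nat).
Local Notation N := (mxdim t n).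

(* The positions i and N+1-i (1-based) become [emb i] and [rev_ord (emb i)]. *)
Definition emb (i : 'I_n) : 'I_N := widen_ord (leq_mxdim t n) i.

Definition vec_diff (i j : 'I_n) : 'M[K]_N :=
  if is_TA t then delta_mx (emb i) (emb j)
  else delta_mx (emb i) (emb j)
       - delta_mx (rev_ord (emb j)) (rev_ord (emb i)).

Definition vec_sum (i j : 'I_n) : 'M[K]_N :=
  delta_mx (emb i) (rev_ord (emb j)) - delta_mx (emb j) (rev_ord (emb i)).

(* Only used for [TB], where N = 2n+1 and n is the middle (0-based) index. *)
Definition vec_short (i : 'I_n) : 'M[K]_N :=
  \matrix_(r, s) (((r == emb i) && (s == n :> nat))%:R
                  - ((r == n :> nat) && (s == rev_ord (emb i)))%:R).

(* e_b: the [pick]s recover the indices of the root b, which are unique; see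
   [root_vec_diff], [root_vec_sum] and [root_vec_short] below. *)
Definition root_vec (b : 'rV[int]_n) : 'M[K]_N :=
  if [pick p : 'I_n * 'I_n | (p.1 < p.2)%N && (b == eps p.1 - eps p.2)]
    is Some p then vec_diff p.1 p.2
  else if [pick p : 'I_n * 'I_n | (p.1 < p.2)%N && (b == eps p.1 + eps p.2)]
    is Some p then vec_sum p.1 p.2
  else if [pick i : 'I_n | b == eps i] is Some i then vec_short i
  else 0.

Lemma epsE (i k : 'I_n) : eps i 0 k = (k == i)%:R.
Proof. by rewrite mxE eqxx. Qed.

Lemma root_vec_diff (i j : 'I_n) :
  (i < j)%N -> root_vec (eps i - eps j) = vec_diff i j.
Proof.
move=> ij; have nij : i != j by rewrite neq_ltn ij.
rewrite /root_vec; case: pickP => [[i' j'] /= /andP[ij' /eqP e]|]; last first.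
  by move=> /(_ (i, j)); rewrite /= ij eqxx.
have := congr1 (fun v : 'rV[int]_n => v 0 i) e.
have := congr1 (fun v : 'rV[int]_n => v 0 j) e.
rewrite !mxE !eqxx /= (eq_sym j i) (negbTE nij).
by case: (eqVneq i i') => [->|_]; case: (eqVneq j j') => [->|_];
  case: (eqVneq i j') => _; case: (eqVneq j i') => _.
Qed.

Lemma root_vec_sum (i j : 'I_n) :
  (i < j)%N -> root_vec (eps i + eps j) = vec_sum i j.
Proof.
move=> ij; have nij : i != j by rewrite neq_ltn ij.
rewrite /root_vec; case: pickP => [[i' j'] /= /andP[ij' /eqP e]|_].
  have nij' : i' != j' by rewrite neq_ltn ij'.
  have := congr1 (fun v : 'rV[int]_n => v 0 j') e.
  rewrite !mxE !eqxx /= (eq_sym j' i') (negbTE nij').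
  by case: (j' == i); case: (j' == j).
case: pickP => [[i' j'] /= /andP[ij' /eqP e]|/(_ (i, j))]; last first.
  by rewrite /= ij eqxx.
have nij' : i' != j' by rewrite neq_ltn ij'.
have := congr1 (fun v : 'rV[int]_n => v 0 i) e.
have := congr1 (fun v : 'rV[int]_n => v 0 j) e.
rewrite !mxE !eqxx /= (eq_sym j i) (negbTE nij).
have /eqP Nij := nij; have /eqP Nij' := nij'.
have swap : i = j' -> j = i' -> False.
  by move=> e1 e2; move: ij ij'; rewrite e1 e2 ltnNge => /negP h /ltnW.
by case: (eqVneq i i') => [ei|_]; case: (eqVneq j j') => [ej|_];
  case: (eqVneq i j') => [e1|_]; case: (eqVneq j i') => [e2|_] // _ _;
  by [congruence | case: swap].
Qed.

Lemma root_vec_short (i : 'I_n) : root_vec (eps i) = vec_short i.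
Proof.
rewrite /root_vec; case: pickP => [[i' j'] /= /andP[ij' /eqP e]|_].
  have nij' : i' != j' by rewrite neq_ltn ij'.
  have := congr1 (fun v : 'rV[int]_n => v 0 j') e.
  by rewrite !mxE !eqxx /= (eq_sym j' i') (negbTE nij'); case: (j' == i).
case: pickP => [[i' j'] /= /andP[ij' /eqP e]|_].
  have nij' : i' != j' by rewrite neq_ltn ij'.
  have := congr1 (fun v : 'rV[int]_n => v 0 i') e.
  have := congr1 (fun v : 'rV[int]_n => v 0 j') e.
  rewrite !mxE !eqxx /= (eq_sym j' i') (negbTE nij').
  case: (eqVneq i' i) => [ei|_]; case: (eqVneq j' i) => [ej|_] //.
  by move: nij'; rewrite ei ej eqxx.
case: pickP => [i' /eqP e|/(_ i)]; last by rewrite eqxx.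
have := congr1 (fun v : 'rV[int]_n => v 0 i) e.
by rewrite !mxE !eqxx /=; case: (eqVneq i i') => [->|].
Qed.

(* [lie_alg] is the set of strictly upper triangular matrices that are, except
   for [TA], antisymmetric about the antidiagonal: see [mem_lie_alg]. *)
Definition lower_part (X : 'M[K]_N) : 'M[K]_N :=
  \matrix_(r, s) (if (s <= r)%N then X r s else 0).

Definition anti_part (X : 'M[K]_N) : 'M[K]_N :=
  \matrix_(r, s) (if is_TA t then 0 else X r s + X (rev_ord s) (rev_ord r)).

Fact lower_part_is_linear : linear lower_part.
Proof.
by move=> a X Y; apply/matrixP => r s; rewrite !mxE; case: leqP => _;
  rewrite ?mulr0 ?addr0.
Qed.
HB.instance Definition _ :=
  GRing.isLinear.Build K 'M[K]_N 'M[K]_N _ lower_part lower_part_is_linear.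

Fact anti_part_is_linear : linear anti_part.
Proof.
move=> a X Y; apply/matrixP => r s; rewrite !mxE.
by case: is_TA; rewrite ?mulr0 ?addr0 // mulrDr addrACA.
Qed.
HB.instance Definition _ :=
  GRing.isLinear.Build K 'M[K]_N 'M[K]_N _ anti_part anti_part_is_linear.

Definition lie_alg : {vspace 'M[K]_N} :=
  (lker (linfun lower_part) :&: lker (linfun anti_part))%VS.

Lemma mem_lie_alg (X : 'M[K]_N) :
  X \in lie_alg <->
  (forall r s : 'I_N, (s <= r)%N -> X r s = 0)
  /\ (~~ is_TA t -> forall r s : 'I_N, X r s = - X (rev_ord s) (rev_ord r)).
Proof.
rewrite memv_cap !memv_ker !lfunE /=; split.
  move=> /andP[/eqP l /eqP a]; split => [r s sr|/negbTE nA r s].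
    by move/matrixP: l => /(_ r s); rewrite !mxE sr.
  move/matrixP: a => /(_ r s); rewrite !mxE nA => /eqP.
  by rewrite addr_eq0 => /eqP.
move=> [l a]; apply/andP; split; apply/eqP/matrixP => r s; rewrite !mxE.
  by case: leqP => // /l.
by case: (boolP (is_TA t)) => // nA; rewrite (a nA r s) addNr.
Qed.

Lemma delta_antisym_mem (a b : 'I_N) : ~~ is_TA t -> (a < b)%N ->
  delta_mx a b - delta_mx (rev_ord b) (rev_ord a) \in lie_alg.
Proof.
move=> nA ab; apply/mem_lie_alg.
split=> [r s sr|_ r s]; rewrite !mxE; last first.
  rewrite !(can2_eq rev_ordK rev_ordK) !rev_ordK opprB.
  by rewrite (andbC (s == b)) (andbC (s == rev_ord a)).
case: (r =P a) => [er|_]; case: (s =P b) => [es|_] /=.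
  by move: sr; rewrite er es leqNgt ab.
all: case: eqP => [er'|_]; case: eqP => [es'|_] /=; rewrite ?subr0 //.
all: move: sr; rewrite er' es' leqNgt /= ltn_sub2l ?ltnS //.
all: exact: leq_ltn_trans ab (ltn_ord b).
Qed.

Lemma root_vec_mem (b : 'rV[int]_n) :
  b \in pos_roots t n -> root_vec b \in lie_alg.
Proof.
have le2 : ~~ is_TA t -> (n.*2 <= N)%N by case: (t) => //= _; rewrite leqnSn.
have vsE (i : 'I_n) (m : 'I_N) : m = n :> nat -> rev_ord m = m ->
    vec_short i = delta_mx (emb i) m - delta_mx (rev_ord m) (rev_ord (emb i)).
  by move=> em rm; apply/matrixP => r s; rewrite !mxE rm -!val_eqE /= em.
rewrite !mem_cat => /or3P[].
- case/mapP => -[i j]; rewrite mem_filter /= => /andP[ij _] ->.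
  rewrite root_vec_diff // /vec_diff.
  case: (boolP (is_TA t)) => [A|nA]; last exact: delta_antisym_mem.
  apply/mem_lie_alg; rewrite A; split=> // r s sr; rewrite mxE.
  by case: eqP => [er|//]; case: eqP => [es|//]; move: sr; rewrite er es leqNgt ij.
- case: (boolP (is_TA t)) => // nA.
  case/mapP => -[i j]; rewrite mem_filter /= => /andP[ij _] ->.
  rewrite root_vec_sum // /vec_sum -{2}[emb j]rev_ordK.
  apply: delta_antisym_mem => //=.
  have := le2 nA; have := ltn_ord j; rewrite -addnn => jn nN.
  by rewrite ltn_subRL (leq_trans _ nN) // -addnS leq_add // (ltn_trans ij).
- move=> bs; have [i -> tB] : exists2 i : 'I_n, b = eps i & t = TB.
    by case: (t) bs => // /mapP[i _ ->]; exists i.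
  have nN : (n < N)%N by rewrite tB /= ltnS -addnn leq_addr.
  rewrite root_vec_short (vsE i (Ordinal nN)) //; last first.
    by apply: val_inj; rewrite /= {1}tB /= subSS -addnn addnK.
  by apply: delta_antisym_mem => //=; rewrite tB.
Qed.

Local Notation g := (subvs_of lie_alg).

Definition lie_dual := 'Hom(g, K^o).

(* [vsproj] only changes the type, by [root_vec_mem] (b being positive). *)
Definition e_ (b : 'rV[int]_n) : g := vsproj lie_alg (root_vec b).

Definition root_basis : (size (pos_roots t n)).-tuple g :=
  [tuple of [seq e_ b | b <- in_tuple (pos_roots t n)]].

(* e_b^*, as a coordinate function on the basis of root vectors; it is 0 by
   convention when b is not a positive root. *)
Definition e_dual (b : 'rV[int]_n) : lie_dual :=
  oapp (fun k : 'I_(size (pos_roots t n)) =>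
          linfun (coord root_basis k : g -> K^o))
       0 (insub (index b (pos_roots t n))).

(* (h.f)(x) = f (h^-1 x h); [vsproj] only changes the type, since h^-1 x h
   belongs to the Lie algebra when h is in the group below. *)
Definition coadj (h : 'M[K]_N) (f : lie_dual) : lie_dual :=
  linfun (fun x : g => f (vsproj lie_alg (invmx h *m vsval x *m h)) : K^o).

End LieAlgebra.

Arguments e_ {K t n} b.

(* [R[i]^o] carries the topology of the complex modulus, and matrices over it
   the topology of entrywise convergence. *)
Definition mexp (R : realType) (N : nat) (X : 'M[R[i]]_N) : 'M[R[i]]_N :=
  limn (series (fun k => (k`!%:R^-1 *: X ^+ k : 'M[R[i]^o]_N))).

Lemma mexp_nilpotent (R : realType) (N M : nat) (X : 'M[R[i]]_N) :
  X ^+ M = 0 -> mexp X = \sum_(k < M) k`!%:R^-1 *: X ^+ k.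
Proof.
move=> X0; pose u k : 'M[R[i]^o]_N := k`!%:R^-1 *: X ^+ k.
have sep : hausdorff_space 'M[R[i]^o]_N.
  move=> A B clAB; apply/matrixP => i j.
  apply: (@norm_hausdorff R[i] R[i]^o) => U V nU nV.
  pose ent (Z : 'M[R[i]^o]_N) := Z i j.
  have [||Z [UZ VZ]] := clAB (ent @^-1` U) (ent @^-1` V).
  - exact/coord_continuous/nU.
  - exact/coord_continuous/nV.
  by exists (Z i j).
apply: (@cvg_lim ('M[R[i]^o]_N : ptopologicalType) sep nat _ _ (series u)).
apply: cvg_near_cst; near=> n.
have Mn : (M <= n)%N by near: n; exists M.
rewrite /series /= -(subnKC Mn) big_mkord big_split_ord /=.
rewrite [X in _ + X]big1 ?addr0 // => k _.
by rewrite /u exprD X0 mul0r scaler0.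
Unshelve. all: by end_near. Qed.

Definition lie_group (R : realType) t n : set 'M[R[i]]_(mxdim t n) :=
  [set mexp X | X in [set X | X \in lie_alg R[i] t n]].
Arguments lie_group : clear implicits.

Definition elem_orbit (R : realType) t n (a : 'rV[int]_n) (c : R[i]) :
    set (lie_dual R[i] t n) :=
  [set coadj h (c *: e_dual R[i] t a) | h in lie_group R t n].
Arguments elem_orbit R t {n} a c.

(* Main.v *)
From HB Require Import structures.
Require Import Defs.
From mathcomp Require Import all_boot all_order all_algebra.
From mathcomp Require Import complex.
From mathcomp Require Import all_classical all_reals all_analysis.
From mathcomp Require Import zify.

Import Order.TTheory GRing.Theory Num.Theory.
Import numFieldNormedType.Exports.

Local Open Scope classical_set_scope.
Local Open Scope ring_scope.

(** Every root is a difference [wt p - wt q] of weights of matrix positions, for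
a unique position [(p, q)] above the diagonal and, outside type A, above the
antidiagonal. The root vector at [(p, q)] is the matrix unit there,
antisymmetrised, and the dual vector reads off the entry at [(p, q)]
([e_dual_root_at]). A root [eps i - eps j], or [eps i] in type B, is moreover in
the left half: outside type A, its column [q] is not beyond the middle. Both
parts of the theorem are instances of one statement on such positions.

Let [h = exp X]. The coadjoint translate of the dual vector at [(p, q)] sends
[x] to the entry of [h^-1 x h] at [(p, q)]. On the root vector at [(r, s)] it
takes the value [u_r w_s], where [u] is row [p] of [h^-1] and [w] is column [q]
of [h] ([coadj_e]); the reflected half of the root vector lies too far to the
right to contribute. Now [u] vanishes before [p], [w] vanishes after [q], and
[u_p = w_q = 1], since [h] is upper unitriangular. So the values are the [u_r]
at [(r, q)], the [w_s] at [(p, s)], the products of the two inside, and zero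
elsewhere: these are the equations of the theorem.

Conversely, the [u_r] and [w_s] strictly between [p] and [q] can be prescribed.
Let [X] have entries [- u_s] in row [p] and [w_r] in column [q], together with
their reflections. The powers of [X] from the second on vanish at these places,
hence row [p] of [exp (- X)] and column [q] of [exp X] are as wanted
([orbit_prescribed]). A functional that satisfies the equations is determined by
its values on this hook, so it lies in the orbit ([orbit_eqsP]).

The hook is exactly the set of singular roots ([singular_on_hook]). Partial sums
of coordinates are nonnegative on positive roots, and on a root of the left half
they are the indicator of the interval from [p] to [q]. Two positive roots with
that sum are therefore adjacent subintervals. *)

Set Implicit Arguments.
Unset Strict Implicit.
Unset Printing Implicit Defensive.

(** * Roots as differences of weights of matrix positions *)

Section Positions.
Variables (t : lie_type) (n : nat).
Local Notation N := (mxdim t n).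

Lemma mxdim_bounds : (is_TA t && (N == n)) || (~~ is_TA t && (n.*2 <= N <=
  n.*2.+1)%N).
Proof. by case: t => /=; rewrite ?eqxx ?leqnn ?leqnSn. Qed.

Lemma mxdim_TB : t = TB -> N = n.*2.+1.
Proof. by move->. Qed.

Lemma mxdim_odd : n.*2.+1 = N -> ~~ is_TA t -> t = TB.
Proof. by case: t => //= e; lia. Qed.

(** The part of the matrix on which an element of the Lie algebra is free:
outside type A, the antidiagonal is zero and the entries below it are
reflections. *)
Definition upper (p q : 'I_N) : bool :=
  (p < q)%N && (is_TA t || (q < rev_ord p)%N).

(** The weight of the [p]-th coordinate vector under the diagonal Cartan
subalgebra; it is odd under the reflection of positions, so it is zero at the
middle position of type B. *)
Definition wt (p : 'I_N) : 'rV[int]_n :=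
  \row_k ((p == k :> nat)%:R - (~~ is_TA t && (rev_ord p == k :> nat))%:R).

Definition root_at (p q : 'I_N) : 'rV[int]_n := wt p - wt q.

Lemma wt_emb (i : 'I_n) : wt (emb t i) = eps i.
Proof.
apply/rowP => k; rewrite !mxE /= -val_eqE (eq_sym (val k)) /=.
have -> : (~~ is_TA t && (mxdim t n - i.+1 == k)%N) = false.
  by have := ltn_ord i; have := ltn_ord k; have := mxdim_bounds; lia.
by rewrite subr0.
Qed.

Lemma wt_rev_emb (i : 'I_n) : ~~ is_TA t -> wt (rev_ord (emb t i)) = - eps i.
Proof.
move=> nA; apply/rowP => k; rewrite !mxE rev_ordK nA /= -val_eqE (eq_sym (val
  k)) /=.
have -> : (mxdim t n - i.+1 == k)%N = false.
  by have := ltn_ord i; have := ltn_ord k; have := mxdim_bounds; lia.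
by rewrite sub0r.
Qed.

Lemma wt_mid (m : 'I_N) : t = TB -> m = n :> nat -> wt m = 0.
Proof.
move=> /mxdim_TB dN mn; apply/rowP => k; rewrite !mxE /= mn; have ltk :=
  ltn_ord k.
have -> : (n == k)%N = false by lia.
have -> : (~~ is_TA t && (N - n.+1 == k)%N) = false by lia.
by rewrite subr0.
Qed.

(** The three families of roots correspond to the column [q] being before, after
or at the middle. *)
Variant upper_spec (p q : 'I_N) : Prop :=
  | UpperDiff (i j : 'I_n) of (i < j)%N & p = emb t i & q = emb t j
  | UpperSum (i j : 'I_n) of (i < j)%N & ~~ is_TA t & p = emb t i & q = rev_ord
    (emb t j)
  | UpperShort (i : 'I_n) of t = TB & p = emb t i & q = n :> nat.

Lemma upperP p q : upper p q -> upper_spec p q.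
Proof.
move=> /andP[pq]; have ltp := ltn_ord p; have ltq := ltn_ord q; have dN :=
  mxdim_bounds => /= up.
have pn : (p < n)%N by lia.
case: (ltnP q n) => qn.
  by apply: (@UpperDiff p q (Ordinal pn) (Ordinal qn)) => //; apply: val_inj.
have nA : ~~ is_TA t by lia.
rewrite (negbTE nA) /= in up.
case: (ltnP (rev_ord q) n) => [rqn|/= rqn].
  apply: (@UpperSum p q (Ordinal pn) (Ordinal rqn)) => //=; try exact: val_inj.
    by lia.
  by apply/ord_inj; rewrite /=; lia.
apply: (@UpperShort p q (Ordinal pn)); try exact: val_inj; last by lia.
by apply: mxdim_odd => //; lia.
Qed.

Lemma root_at_pos_root p q : upper p q -> root_at p q \in pos_roots t n.
Proof.
move=> /upperP[i j ij -> ->|i j ij nA -> ->|i tB -> qn];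
  rewrite /root_at !mem_cat !wt_emb.
- by apply/or3P/Or31/mapP; exists (i, j); rewrite // mem_filter ij mem_enum.
- rewrite (negbTE nA) wt_rev_emb // opprK.
  by apply/or3P/Or32/mapP; exists (i, j); rewrite // mem_filter ij mem_enum.
- by rewrite wt_mid // subr0 {-1}tB map_f ?orbT // mem_enum.
Qed.

Lemma upper_diff (i j : 'I_n) : (i < j)%N -> upper (emb t i) (emb t j).
Proof.
move=> ij; rewrite /upper /= ij /=; have := ltn_ord j.
by have := mxdim_bounds; lia.
Qed.

Lemma pos_rootP b : b \in pos_roots t n ->
  exists p q, upper p q /\ b = root_at p q.
Proof.
rewrite !mem_cat => /or3P[].
- case/mapP => -[i j]; rewrite mem_filter /= => /andP[ij _] ->.
  by exists (emb t i), (emb t j); rewrite /root_at !wt_emb upper_diff.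
- case: (boolP (is_TA t)) => // nA.
  case/mapP => -[i j]; rewrite mem_filter /= => /andP[ij _] ->.
  exists (emb t i), (rev_ord (emb t j));
    rewrite /root_at wt_emb wt_rev_emb // opprK.
  split=> //; rewrite /upper (negbTE nA) /=; have := ltn_ord j.
  by have := mxdim_bounds; lia.
- move=> bs; have [i -> tB] : exists2 i : 'I_n, b = eps i & t = TB.
    by case: (t) bs => // /mapP[i _ ->]; exists i.
  have nN : (n < N)%N by rewrite tB /= ltnS -addnn leq_addr.
  exists (emb t i), (Ordinal nN); rewrite /root_at wt_emb wt_mid // subr0.
  split=> //; rewrite /upper /=; have := ltn_ord i.
  by have := mxdim_TB tB; lia.
Qed.

Section Unit.
Variable K : fieldType.

(** Column [n] is its own reflection in type B, so this formula also covers the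
short root vectors. *)
Definition root_unit (p q : 'I_N) : 'M[K]_N :=
  delta_mx p q - (~~ is_TA t)%:R *: delta_mx (rev_ord q) (rev_ord p).

Lemma root_vec_root_at p q : upper p q ->
  root_vec K t (root_at p q) = root_unit p q.
Proof.
move=> u; case: (upperP u) => [i j ij -> ->|i j ij nA -> ->|i tB -> qn].
- rewrite /root_at !wt_emb root_vec_diff // /vec_diff /root_unit.
  by case: is_TA; rewrite ?scale1r ?scale0r ?subr0.
- rewrite /root_at wt_emb wt_rev_emb // opprK root_vec_sum // /vec_sum
  /root_unit.
  by rewrite nA scale1r rev_ordK.
- rewrite /root_at wt_emb wt_mid // subr0 root_vec_short /root_unit.
  have nA : ~~ is_TA t by rewrite tB.
  have -> : rev_ord q = q.
    by apply: ord_inj => /=; rewrite qn; have := mxdim_TB tB; lia.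
  by apply/matrixP => r s; rewrite !mxE -!val_eqE /= qn nA mul1r.
Qed.

(** The reflection of an upper position is below the antidiagonal, so it never
is another upper position. *)
Lemma root_unitE r s p q : upper r s -> upper p q ->
  root_unit r s p q = ((p == r) && (q == s))%:R.
Proof.
move=> /andP[rs urs] /andP[pq upq]; rewrite !mxE.
case: (boolP (is_TA t)) urs upq => [A|nA] /= urs upq;
  first by rewrite mul0r subr0.
suff -> : (p == rev_ord s) && (q == rev_ord r) = false by rewrite mulr0 subr0.
apply/andP => -[/eqP ep /eqP eq]; move: upq urs rs; rewrite ep eq /=.
by have := ltn_ord r; have := ltn_ord s; lia.
Qed.

Lemma root_unit_inj r s p q : upper r s -> upper p q ->
  root_unit r s = root_unit p q -> r = p /\ s = q.
Proof.
move=> u u' e; have := root_unitE u u; rewrite e root_unitE // !eqxx.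
by case: eqP => [->|_]; case: eqP => [->|_] //= /eqP; rewrite eq_sym oner_eq0.
Qed.
End Unit.

(** A root determines its root vector, whose only nonzero upper entry is the
position of the root. *)
Lemma root_at_inj r s p q : upper r s -> upper p q ->
  root_at r s = root_at p q -> r = p /\ s = q.
Proof.
move=> u u' e; apply: (@root_unit_inj rat) => //.
by rewrite -!root_vec_root_at // e.
Qed.

(** The coordinates of a root add up to 0, 2 or 1 in the three families, which
are therefore disjoint; within a family, positions tell roots apart. *)
Lemma uniq_pos_roots : uniq (pos_roots t n).
Proof.
pose tot (b : 'rV[int]_n) := \sum_k b 0 k.
have totD a b : tot (a + b) = tot a + tot b.
  by rewrite -big_split; apply: eq_bigr => k _; rewrite mxE.
have tot1 i : tot (eps i) = 1.
  rewrite /tot (bigD1 i) //= epsE eqxx big1 ?addr0 // => k /negbTE ki.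
  by rewrite epsE ki.
have totN i : tot (- eps i) = - 1.
  by rewrite -(tot1 i) -sumrN; apply: eq_bigr => k _; rewrite mxE.
have u12 : uniq (lt_pairs n) by rewrite filter_uniq // enum_uniq.
have lt12 p : p \in lt_pairs n -> (p.1 < p.2)%N by rewrite mem_filter =>
  /andP[].
rewrite !cat_uniq; apply/and5P; split.
- rewrite map_inj_in_uniq // => -[i j] [i' j'] /lt12/= ij /lt12/= ij' e.
  have [] := @root_at_inj (emb t i) (emb t j) (emb t i') (emb t j').
  - exact: upper_diff.
  - exact: upper_diff.
  - by rewrite /root_at !wt_emb.
  by move=> /(congr1 val)/= e1 /(congr1 val)/= e2; congr pair; apply: ord_inj.
- apply/hasPn => b; rewrite mem_cat => /orP[].
    case: is_TA => // /mapP[p _ ->]; apply/mapP => -[p' _] /(congr1 tot).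
    by rewrite !totD totN !tot1.
  case: t => // /mapP[p _ ->]; apply/mapP => -[p' _] /(congr1 tot).
  by rewrite !totD totN !tot1.
- case: (boolP (is_TA t)) => // nA.
  have u (i j : 'I_n) : (i < j)%N -> upper (emb t i) (rev_ord (emb t j)).
    move=> ij; rewrite /upper (negbTE nA) /=; have := ltn_ord j.
    by have := mxdim_bounds; lia.
  rewrite map_inj_in_uniq // => -[i j] [i' j'] /lt12/= ij /lt12/= ij' e.
  have [] := @root_at_inj (emb t i) (rev_ord (emb t j)) (emb t i') (rev_ord
    (emb t j')).
  - exact: u.
  - exact: u.
  - by rewrite /root_at !wt_emb !wt_rev_emb // !opprK.
  move=> /(congr1 val)/= e1 /rev_ord_inj/(congr1 val)/= e2.
  by congr pair; apply: ord_inj.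
- apply/hasPn => b; case: t => // /mapP[p _ ->]; apply/mapP =>
  -[p' _] /(congr1 tot).
  by rewrite !totD !tot1.
- case: t => //; rewrite map_inj_uniq ?enum_uniq // =>
  i i' /(congr1 (fun b : 'rV_n => b 0 i)).
  by rewrite !epsE eqxx; case: eqP => // ->.
Qed.

(** These sums are nonnegative on positive roots, and they show where a root
starts and stops. *)
Definition psum (k : 'I_n) (b : 'rV[int]_n) : int :=
  \sum_(l < n | (l <= k)%N) b 0 l.

Lemma psumD k a b : psum k (a + b) = psum k a + psum k b.
Proof. by rewrite -big_split; apply: eq_bigr => l _; rewrite mxE. Qed.

Lemma psum_wt k p :
  psum k (wt p) = (p <= k)%N%:R - (~~ is_TA t && (rev_ord p <= k)%N)%:R.
Proof.
have ind m : \sum_(l < n | (l <= k)%N) (m == l :> nat)%:R = (m <= k)%N%:R :>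
  int.
  case: leqP => [mk|km]; last first.
    by rewrite big1 // => l lk; case: eqP => // e; move: km;
      rewrite e ltnNge lk.
  rewrite (bigD1 (Ordinal (leq_ltn_trans mk (ltn_ord k)))) //= eqxx big1 ?addr0
    //.
  move=> l /andP[_]; rewrite -val_eqE eq_sym => /negbTE lm.
  by rewrite [_ == _]lm.
rewrite -(ind p) /psum; under eq_bigr do rewrite mxE.
rewrite sumrB; congr (_ - _); case: (is_TA t) => /=; first by rewrite big1.
exact: ind.
Qed.

Lemma psum_root_at k p q : psum k (root_at p q) =
  (p <= k)%N%:R - (~~ is_TA t && (rev_ord p <= k)%N)%:R
  - ((q <= k)%N%:R - (~~ is_TA t && (rev_ord q <= k)%N)%:R).
Proof.
rewrite /root_at psumD psum_wt; congr (_ + _); rewrite -psum_wt -sumrN.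
by apply: eq_bigr => l _; rewrite mxE.
Qed.

End Positions.

(** * The roots that are singular for a root of the left half *)

Section Singular.
Variables (t : lie_type) (n : nat).
Local Notation N := (mxdim t n).
Variables (p q : 'I_N).
Hypotheses (upq : upper p q) (q_mid : is_TA t || (q <= rev_ord q)%N).
Implicit Types r s : 'I_N.

(** The positions at which the values of a point of the orbit of [root_at p q]
are free. On upper positions they form the part of row [p] before column [q] and
the part of column [q] after row [p]. *)
Definition on_hook (r s : 'I_N) : bool :=
  (r == p) && (s < q)%N || (s == q) && (p < r)%N.

Lemma hook_upper (r : 'I_N) : (p < r)%N -> (r < q)%N -> upper p r /\ upper r q.
Proof.
move: upq q_mid => /andP[pq]; rewrite /upper /= => u m pr rq.
have := ltn_ord q.
by split; lia.
Qed.

(** By [psum_root_at], the partial sums of the root at [(r, s)] are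
[A k r + B k s - (A k s + B k r)]; the lemmas below avoid the subtraction. *)
Let A (k x : nat) : nat := (x <= k)%N.
Let B (k x : nat) : nat := ~~ is_TA t && (N - x.+1 <= k)%N.

Lemma psum_ge0 k (r s : 'I_N) : upper r s -> (A k s + B k r <= A k r + B k s)%N.
Proof.
move=> /andP[rs _]; rewrite leq_add // /A /B.
  by case: (leqP s k) => // sk; rewrite (ltnW (leq_trans rs sk)).
case: (is_TA t) => //=; case: (leqP (N - r.+1)%N k) => // rk.
by rewrite (leq_trans _ rk) // leq_sub2l // ltnW.
Qed.

(** When the column is not beyond the middle, reflected positions are out of the
range of the partial sums, and only the interval between row and column
shows. *)
Lemma psum_interval (k : 'I_n) (r s : 'I_N) : upper r s ->
  is_TA t || (s.*2 < N)%N ->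
  (A k r + B k s = A k s + B k r + ((r <= k) && (k < s)))%N.
Proof.
move=> /andP[rs _] sn; have ltk := ltn_ord k; have dN := mxdim_bounds t n.
have B0 (x : 'I_N) : is_TA t || (x.*2 < N)%N -> B k x = 0%N.
  by rewrite /B; have := ltn_ord x; case: (is_TA t) dN => //= dN ltx xn; lia.
rewrite !B0 //; last by lia.
by rewrite /A; lia.
Qed.

(** These are the roots [eps i + eps j]: both coordinates count in the total
sum. *)
Lemma psum_sum (k : 'I_n) (r s : 'I_N) : upper r s -> k.+1 = n -> ~~ is_TA t ->
  (N <= s.*2)%N ->
  (A k r + B k s = A k s + B k r + 2)%N.
Proof.
rewrite /upper /A /B => /andP[rs] /= us kn /negbTE nA ns.
rewrite nA /= in us *; have := mxdim_bounds t n; rewrite nA /= => dN; have :=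
  ltn_ord s => lts.
have -> : (r <= k)%N = true by lia.
have -> : (s <= k)%N = false by lia.
have -> : (N - s.+1 <= k)%N = true by lia.
have -> : (N - r.+1 <= k)%N = false by lia.
by [].
Qed.

(** The total sum of [root_at p q] is at most 1, so neither summand is of the
form [eps i + eps j]. Then the partial sums say that the intervals of the
summands partition the interval from [p] to [q]: one of them starts at [p] and
the other stops at [q]. *)
Lemma root_sum_on_hook r s (r' s' : 'I_N) : upper r s -> upper r' s' ->
  root_at r s + root_at r' s' = root_at p q -> on_hook r s.
Proof.
move=> urs urs' e.
have qn : is_TA t || (q.*2 < N)%N.
  have := mxdim_bounds t n; have := ltn_ord q; move: q_mid => /=.
  by case: (is_TA t) => //=; lia.
have H (k : 'I_n) :
  (A k r + B k s + (A k r' + B k s') + (A k q + B k p)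
   = A k s + B k r + (A k s' + B k r') + (A k p + B k q))%N.
  have := congr1 (psum k) e; rewrite psumD !psum_root_at /= !natz /A /B.
  do 12![move: (nat_of_bool _) => ?]; lia.
have {}H (k : 'I_n) :
  (A k r + B k s + (A k r' + B k s')
   = A k s + B k r + (A k s' + B k r') + ((p <= k) && (k < q)))%N.
  have := H k; have := psum_interval k upq qn.
  by do 6![move: (A k _) (B k _) => ? ?]; lia.
(* A summand [eps i + eps j] would contribute 2 to the total sum. *)
have nS : is_TA t || (s.*2 < N)%N /\ is_TA t || (s'.*2 < N)%N.
  have n0 : (n.-1 < n)%N by have := mxdim_bounds t n; have := ltn_ord q;
    have /andP[pq _] := upq; lia.
  have k1 : (Ordinal n0).+1 = n by rewrite /= prednK // (leq_ltn_trans _ n0).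
  have := H (Ordinal n0); have := psum_ge0 n.-1 urs; have := psum_ge0 n.-1 urs'.
  have := psum_sum urs k1; have := psum_sum urs' k1.
  rewrite /=; case: (is_TA t) => //= /(_ isT) h1 /(_ isT) h2;
    rewrite !(ltnNge _ N).
  case: (leqP N s.*2) h2 => [_ /(_ isT) ->|_ _].
    by move=> *; lia.
  case: (leqP N s'.*2) h1 => [_ /(_ isT) ->|//].
  by move=> *; lia.
have {}H (k : nat) : (k < n)%N ->
  (((r <= k) && (k < s)) + ((r' <= k) && (k < s')) = ((p <= k) && (k < q)))%N.
  move=> kn; have := H (Ordinal kn).
  by rewrite (psum_interval _ urs nS.1) (psum_interval _ urs' nS.2) /=; lia.
have pq : (p < q)%N by case/andP: upq.
have [rs _] := andP urs; have [rs' _] := andP urs'.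
have [sn sn'] : (s <= n)%N /\ (s' <= n)%N.
  by have := mxdim_bounds t n; have := ltn_ord s; have := ltn_ord s'; case: nS;
    case: (is_TA t) => /=; lia.
have in1 k : (r <= k < s)%N -> (p <= k < q)%N.
  move=> rk; have kn : (k < n)%N by case/andP: rk => _ /leq_trans->.
  by have := H k kn; rewrite rk; case: (p <= k < q)%N.
have in2 k : (r' <= k < s')%N -> (p <= k < q)%N.
  move=> rk; have kn : (k < n)%N by case/andP: rk => _ /leq_trans->.
  by have := H k kn; rewrite rk addnC; case: (p <= k < q)%N.
have qn' : (q <= n)%N.
  by have := mxdim_bounds t n; have := ltn_ord q; case: (is_TA t) qn => /=; lia.
have /andP[pr rq] : (p <= r < q)%N by apply: in1; rewrite leqnn.
have /andP[pr' rq'] : (p <= r' < q)%N by apply: in2; rewrite leqnn.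
have sq : (s <= q)%N.
  by have := in1 s.-1; clear -rs; lia.
have sq' : (s' <= q)%N.
  by have := in2 s'.-1; clear -rs'; lia.
(* It is enough to test which interval contains each of [p], [r'], [r] and
[q.-1]. *)
have Hp : (((r <= p) && (p < s)) + ((r' <= p) && (p < s')) = 1)%N.
  by rewrite H ?leqnn ?pq // (leq_trans pq).
have Hr : (((r <= r') && (r' < s)) + 1 = 1)%N.
  have := H r' (leq_trans rs' sn').
  by rewrite pr' rq' leqnn rs'.
have Hr0 : (1 + ((r' <= r) && (r < s')) = 1)%N.
  by have := H r (leq_trans rs sn); rewrite pr rq leqnn rs.
have Hq : (((r <= q.-1) && (q.-1 < s)) + ((r' <= q.-1) && (q.-1 < s')) = 1)%N.
  rewrite H; first by clear -pq; case: (q : nat) pq => //= m; rewrite ltnS =>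
    ->; rewrite leqnn.
  by clear -pq qn'; lia.
rewrite /on_hook -!val_eqE /=; clear -Hp Hr Hr0 Hq pr pr' sq sq' rs rs' pq rq';
  lia.
Qed.

Lemma singular_on_hook r s : upper r s ->
  (root_at r s \in singular_roots t (root_at p q)) = on_hook r s.
Proof.
move=> urs; apply/idP/idP.
  rewrite mem_filter => /andP[/hasP[c /pos_rootP[r' [s' [u' ->]]] /eqP e] _].
  exact: root_sum_on_hook e.
move=> sg; rewrite mem_filter root_at_pos_root // andbT.
have [rs _] := andP urs; apply/hasP.
case/orP: sg => /andP[/eqP e lt].
  rewrite e in urs rs *; have [_ v] := hook_upper rs lt.
  by exists (root_at s q); rewrite ?root_at_pos_root // /root_at addrA subrK.
rewrite e in urs rs *; have [v _] := hook_upper lt rs.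
by exists (root_at p r); rewrite ?root_at_pos_root // addrC /root_at addrA
  subrK.
Qed.
End Singular.

(** * Matrix entries as coordinates on the root vectors *)

Section Basis.
Variables (K : fieldType) (t : lie_type) (n : nat).
Hypothesis char_neq2 : 2%:R != 0 :> K.
Local Notation N := (mxdim t n).
Local Notation g := (subvs_of (lie_alg K t n)).
Implicit Types p q r s : 'I_N.

(** On the antidiagonal an antisymmetric entry is its own opposite, whence the
condition on the characteristic. *)
Lemma lie_alg_eq0 (X : 'M[K]_N) : X \in lie_alg K t n ->
  (forall p q, upper p q -> X p q = 0) -> X = 0.
Proof.
move=> /mem_lie_alg[low anti] X0; apply/matrixP => r s; rewrite mxE.
case: (leqP s r) => [/low//|rs].
case: (boolP (upper r s)) => [/X0//|]; rewrite /upper rs negb_or /= =>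
  /andP[nA].
rewrite -leqNgt leq_eqVlt => /orP[/eqP e|lt].
  have e' : s = rev_ord r by apply: ord_inj.
  have := anti nA r s; rewrite e' rev_ordK => /eqP.
  by rewrite -addr_eq0 -mulr2n -mulr_natl mulf_eq0 (negbTE char_neq2) /= =>
    /eqP.
rewrite anti // X0 ?oppr0 // /upper rev_ordK (negbTE nA) /=.
by have := ltn_ord r; have := ltn_ord s; lia.
Qed.

Lemma e_root_at p q : upper p q -> vsval (e_ (root_at p q) : g) = root_unit K p
  q.
Proof.
by move=> u; rewrite /e_ vsprojK ?root_vec_root_at // -root_vec_root_at //
  root_vec_mem ?root_at_pos_root.
Qed.

Let sz := size (pos_roots t n).

Lemma root_pos_ex (k : 'I_sz) :
  exists pq : 'I_N * 'I_N, upper pq.1 pq.2 && ((pos_roots t n)`_k == root_at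
    pq.1 pq.2).
Proof.
have /pos_rootP[p [q [u ->]]] := mem_nth 0 (ltn_ord k).
by exists (p, q); rewrite u eqxx.
Qed.

Definition root_pos k := xchoose (root_pos_ex k).

Lemma root_posP k : upper (root_pos k).1 (root_pos k).2 /\
  (pos_roots t n)`_k = root_at (root_pos k).1 (root_pos k).2.
Proof. by have /andP[? /eqP] := xchooseP (root_pos_ex k). Qed.

Lemma root_posE p q : upper p q -> exists k, root_pos k = (p, q).
Proof.
move=> u; have := root_at_pos_root u; rewrite -index_mem => lt.
exists (Ordinal lt); have [v e] := root_posP (Ordinal lt).
rewrite /= nth_index ?root_at_pos_root // in e.
by have [e1 e2] := root_at_inj u v e; rewrite [LHS]surjective_pairing -e1 -e2.
Qed.

Lemma root_pos_inj : injective root_pos.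
Proof.
move=> k l e; apply/ord_inj/eqP.
rewrite -(nth_uniq 0 (ltn_ord k) (ltn_ord l) (uniq_pos_roots t n)).
by have [_ ->] := root_posP k; have [_ ->] := root_posP l; rewrite e.
Qed.

Lemma root_basis_nth (k : 'I_sz) :
  (root_basis K t n)`_k = e_ (root_at (root_pos k).1 (root_pos k).2).
Proof.
by rewrite -(root_posP k).2 (nth_map 0).
Qed.

Lemma comb_root_basis_at (c : 'I_sz -> K) k :
  vsval (\sum_(l < sz) c l *: (root_basis K t n)`_l) (root_pos k).1 (root_pos
    k).2 = c k.
Proof.
have -> : vsval (\sum_(l < sz) c l *: (root_basis K t n)`_l)
    = \sum_(l < sz) c l *: vsval (root_basis K t n)`_l by exact: linear_sum.
have u l := (root_posP l).1.
have E l : (c l *: vsval (root_basis K t n)`_l) (root_pos k).1 (root_pos k).2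
    = c l * (l == k)%:R.
  rewrite mxE root_basis_nth e_root_at // root_unitE //; congr (_ * _%:R).
  rewrite -(inj_eq root_pos_inj) [in RHS]eq_sym.
  by rewrite [in RHS](surjective_pairing (root_pos k)) [in
    RHS](surjective_pairing (root_pos l)).
rewrite summxE (bigD1 k) // E eqxx mulr1 -[RHS]addr0; congr (_ + _).
by apply: big1 => l lk; rewrite E (negbTE lk) mulr0.
Qed.

(** Both sides have the same upper entries. *)
Lemma root_basis_exp (x : g) :
  x = \sum_(k < sz) vsval x (root_pos k).1 (root_pos k).2 *: (root_basis K t
    n)`_k.
Proof.
apply/val_inj/subr0_eq/lie_alg_eq0; first by rewrite rpredB ?subvsP.
move=> p q u; have [k e] := root_posE u.
have := comb_root_basis_at (fun k => vsval x (root_pos k).1 (root_pos k).2) k.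
rewrite [in RHS]e [in LHS]e => h; rewrite mxE [in X in _ + X]mxE.
by apply/eqP; rewrite subr_eq0; apply/eqP; exact: esym.
Qed.

Lemma root_basis_free : free (root_basis K t n).
Proof.
by apply/freeP => c c0 k; rewrite -(comb_root_basis_at c k) c0 linear0 mxE.
Qed.

(** Upper entries of combinations of root vectors are the coefficients, so the
root vectors are free as well as generating, and dual vectors are entries. *)
Lemma e_dual_root_at p q (x : g) : upper p q ->
  e_dual K t (root_at p q) x = vsval x p q.
Proof.
move=> u; rewrite /e_dual; have := root_at_pos_root u; rewrite -index_mem => lt.
rewrite insubT /= lfunE /= {1}(root_basis_exp x).
have := @coord_sum_free _ _ _ (root_basis K t n) _ (Ordinal lt) root_basis_free.
move=> ->.
have [v e] := root_posP (Ordinal lt).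
rewrite /= nth_index ?root_at_pos_root // in e.
by have [e1 e2] := root_at_inj u v e; rewrite -e1 -e2.
Qed.

Lemma dual_ext (f1 f2 : lie_dual K t n) :
  (forall p q, upper p q -> f1 (e_ (root_at p q)) = f2 (e_ (root_at p q))) ->
    f1 = f2.
Proof.
move=> f12; apply/lfunP => x; rewrite (root_basis_exp x) !linear_sum.
apply: eq_bigr => k _; rewrite !linearZ root_basis_nth; congr (_ *: _).
exact/f12/(root_posP k).1.
Qed.

End Basis.

(** * Exponentials of nilpotent matrices and antidiagonal transposes *)

(** Both factors are values at [X] of truncated exponential polynomials. Below
degree [M], the coefficients of their product are those of [1], by the binomial
formula for [(-1 + 1) ^+ i]; from degree [M] on, the powers of [X] vanish. *)
Lemma exp_sum_mulN (K : numFieldType) (N M : nat) (X : 'M[K]_N) : X ^+ M = 0 ->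
  (\sum_(k < M) k`!%:R^-1 *: X ^+ k) *m (\sum_(k < M) k`!%:R^-1 *: (- X) ^+ k)
    = 1%:M.
Proof.
case: N X => [|N] X X0; first by rewrite [LHS]flatmx0 [RHS]flatmx0.
pose E (c : K) : {poly K} := \poly_(k < M) (c ^+ k / k`!%:R).
have EE c : horner_alg X (E c) = \sum_(k < M) k`!%:R^-1 *: (c *: X) ^+ k.
  rewrite /E poly_def linear_sum; apply: eq_bigr => k _.
  by rewrite linearZ /= rmorphXn /= horner_algX exprZn scalerA mulrC mulr_algl.
have -> : \sum_(k < M) k`!%:R^-1 *: X ^+ k = horner_alg X (E 1).
  by rewrite EE scale1r.
have -> : \sum_(k < M) k`!%:R^-1 *: (- X) ^+ k = horner_alg X (E (-1)).
  by rewrite EE scaleN1r.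
rewrite mulmxE -rmorphM /= -(poly_take_drop M (E 1 * E (-1))).
rewrite rmorphD /= rmorphM /= rmorphXn /= horner_algX X0 mulr0 addr0.
(* The part of the product of degree at least [M] is killed by [X ^+ M = 0]. *)
suff -> : take_poly M (E 1 * E (-1)) = 1 by rewrite rmorph1.
have M_gt0 : (0 < M)%N.
  by case: M X0 {E EE} => // /eqP; rewrite expr0 oner_eq0.
apply/polyP => i; rewrite coef_take_poly coef1.
case: ltnP => [iM|Mi]; last by rewrite gtn_eqF // (leq_trans M_gt0).
rewrite coefM; under eq_bigr => j _.
  have ji : (j <= i)%N by rewrite -ltnS.
  rewrite !coef_poly (leq_ltn_trans ji iM) (leq_ltn_trans (leq_subr _ _) iM).
  rewrite mulrACA -invfM -natrM.
  have -> : (j`! * (i - j)`!)%:R^-1 = i`!%:R^-1 * 'C(i, j)%:R :> K.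
    rewrite -(bin_fact ji) [in RHS]natrM invfM mulrC mulrA divff ?mul1r //.
    by rewrite pnatr_eq0 -lt0n bin_gt0.
  rewrite mulrCA (mulrC (1 ^+ j)) mulr_natr.
  over.
rewrite -mulr_sumr -exprDn addNr expr0n.
by case: i {iM} => [|i]; rewrite ?mulr0 //= fact0 invr1 mulr1.
Qed.

(** The transpose for the bilinear form with antidiagonal Gram matrix; outside
type A, the Lie algebra consists of skew elements for this involution. *)
Definition antitr (R : Type) N (X : 'M[R]_N) : 'M[R]_N :=
  \matrix_(r, s) X (rev_ord s) (rev_ord r).

Section Antitr.
Variables (K : fieldType) (N : nat).
Implicit Types X Y : 'M[K]_N.

Lemma antitrM X Y : antitr (X *m Y) = antitr Y *m antitr X.
Proof.
apply/matrixP => r s; rewrite !mxE (reindex_inj rev_ord_inj).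
by apply: eq_bigr => k _; rewrite !mxE mulrC.
Qed.

Lemma antitrX X k : antitr (X ^+ k) = antitr X ^+ k.
Proof.
elim: k => [|k IHk]; last by rewrite exprS exprSr -IHk; apply: antitrM.
apply/matrixP => r s; rewrite !expr0 !mxE (inj_eq rev_ord_inj).
by rewrite eq_sym.
Qed.

Definition strictly_upper X := forall r s : 'I_N, (s <= r)%N -> X r s = 0.

Definition upper_triangular X := forall r s : 'I_N, (s < r)%N -> X r s = 0.

Lemma strictly_upper_pow X k : strictly_upper X ->
  forall r s : 'I_N, (s < r + k)%N -> (X ^+ k) r s = 0.
Proof.
move=> Xu; elim: k => [|k IHk] r s sr.
  by rewrite expr0 mxE -val_eqE /= gtn_eqF // -(addn0 r).
rewrite exprSr [LHS]mxE big1 // => l _.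
case: (ltnP l (r + k)) => [/IHk->|rl]; first by rewrite mul0r.
by rewrite [X in _ * X]Xu ?mulr0 // (leq_trans _ rl) // -ltnS -addnS.
Qed.

Lemma strictly_upper_nilpotent X m : strictly_upper X -> (N <= m)%N ->
  X ^+ m = 0.
Proof.
move=> Xu Nm; apply/matrixP => r s; rewrite strictly_upper_pow ?mxE //.
by apply: leq_trans (ltn_ord s) _; apply: leq_trans Nm (leq_addl _ _).
Qed.

Lemma strictly_upperM h X h' : upper_triangular h -> strictly_upper X ->
  upper_triangular h' ->
  strictly_upper (h *m X *m h').
Proof.
move=> hu Xu hu' r s sr; rewrite mxE big1 // => l _.
case: (ltnP s l) => [/hu'->|ls]; rewrite ?mulr0 // mxE big1 ?mul0r // => m _.
case: (ltnP m r) => [/hu->|rm]; rewrite ?mul0r // Xu ?mulr0 //.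
exact: leq_trans ls (leq_trans sr rm).
Qed.

End Antitr.

(** * The coadjoint action of an exponential *)

Section Coadjoint.
Variables (K : numFieldType) (t : lie_type) (n : nat).
Local Notation N := (mxdim t n).
Local Notation L := (lie_alg K t n).
Implicit Types p q r s : 'I_N.

Lemma lie_algP (X : 'M[K]_N) :
  X \in L <-> strictly_upper X /\ (~~ is_TA t -> antitr X = - X).
Proof.
split=> [/mem_lie_alg[low anti]|[low anti]].
  split=> // nA; apply/matrixP => r s; rewrite !mxE.
  by rewrite (anti nA r s) opprK.
apply/mem_lie_alg; split=> // nA r s.
by have /matrixP/(_ r s) := anti nA; rewrite !mxE => ->; rewrite opprK.
Qed.

(** The exponential on strictly upper triangular matrices: see [mexp_lie_alg].
The bound [N.+2], rather than [N], lets the terms of degree 0 and 1 be split off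
in every dimension. *)
Definition texp (X : 'M[K]_N) : 'M[K]_N := \sum_(k < N.+2) k`!%:R^-1 *: X ^+ k.

Section TruncatedExp.
Variable X : 'M[K]_N.
Hypothesis XL : X \in L.

Let Xu : strictly_upper X. Proof. by case/lie_algP: XL. Qed.

Lemma texpE r s : texp X r s = (r == s)%:R + X r s + \sum_(k < N) k.+2`!%:R^-1
  * (X ^+ k.+2) r s.
Proof.
rewrite /texp big_ord_recl big_ord_recl /= fact0 invr1 !scale1r expr0 expr1
  addrA.
rewrite mxE [X in X + _]mxE [X in X + _ + _]mxE summxE; congr (_ + _).
by apply: eq_bigr => k _; rewrite mxE.
Qed.

Lemma texp_upper : upper_triangular (texp X).
Proof.
move=> r s sr; rewrite texpE Xu 1?ltnW // big1 => [|k _].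
  by rewrite -val_eqE gtn_eqF // !addr0.
by rewrite strictly_upper_pow ?mulr0 // (leq_trans sr) ?leq_addr.
Qed.

Lemma texp_diag r : texp X r r = 1.
Proof.
rewrite texpE Xu // eqxx big1 ?addr0 // => k _.
by rewrite strictly_upper_pow ?mulr0 // addnS ltnS leq_addr.
Qed.

Lemma texpV : texp X *m texp (- X) = 1%:M.
Proof. by apply: exp_sum_mulN; apply: strictly_upper_nilpotent => //;
  rewrite leqW. Qed.

Lemma antitr_texp : ~~ is_TA t -> antitr (texp X) = texp (- X).
Proof.
move=> nA; have [_ /(_ nA) <-] := (lie_algP X).1 XL.
apply/matrixP => r s; rewrite mxE /texp !summxE; apply: eq_bigr => k _.
by rewrite -antitrX !mxE.
Qed.

Lemma invmx_texp : invmx (texp X) = texp (- X).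
Proof.
have [u _] := mulmx1_unit texpV.
by rewrite -[RHS]mul1mx -(mulVmx u) -mulmxA texpV mulmx1.
Qed.

End TruncatedExp.

Lemma oppr_lie_alg (X : 'M[K]_N) : X \in L -> - X \in L.
Proof. by rewrite rpredN. Qed.

(** Outside type A, [exp X] is orthogonal for [antitr], as [X] is skew; so
conjugation by it preserves skew matrices. *)
Lemma conj_texp (X x : 'M[K]_N) : X \in L -> x \in L ->
  texp (- X) *m x *m texp X \in L.
Proof.
move=> XL xL; have NL := oppr_lie_alg XL; have [xu xa] := (lie_algP x).1 xL.
apply/lie_algP; split=> [|nA].
  by apply: strictly_upperM => //; apply: texp_upper.
rewrite !antitrM antitr_texp // antitr_texp // opprK xa //.
by rewrite mulmxA mulmxN mulNmx.
Qed.

(** The right-hand side is linear in [x], so that [linfun] does not change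
it. *)
Lemma coadjE (h : 'M[K]_N) (f : lie_dual K t n) x :
  coadj h f x = f (vsproj L (invmx h *m vsval x *m h)).
Proof.
pose F (x : subvs_of L) := f (vsproj L (invmx h *m vsval x *m h)) : K^o.
have Flin : linear F.
  move=> a y z; rewrite /F.
  have -> : vsval (a *: y + z) = a *: vsval y + vsval z by [].
  by rewrite mulmxDr mulmxDl -scalemxAr -scalemxAl !linearP.
pose FL : {linear subvs_of L -> K^o} := HB.pack F (GRing.isLinear.Build _ _ _ _
  F Flin).
exact: (lfunE FL).
Qed.

(** A root of the left half only sees the matrix unit at [(r, s)] in the root
vector: its reflection is at row [rev_ord s] and column [rev_ord r > q], and
column [q] of the triangular matrix [texp X] is zero from row [rev_ord r] on. *)
Lemma coadj_e (X : 'M[K]_N) p q r s : X \in L -> upper p q ->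
  is_TA t || (q <= rev_ord q)%N ->
  upper r s ->
  coadj (texp X) (e_dual K t (root_at p q)) (e_ (root_at r s)) = texp (- X) p r
    * texp X s q.
Proof.
move=> XL upq qm urs; have two : 2%:R != 0 :> K by rewrite pnatr_eq0.
rewrite coadjE e_dual_root_at // vsprojK invmx_texp ?conj_texp ?subvsP //
  e_root_at //.
rewrite /root_unit mulmxBr mulmxBl mxE -scalemxAr -scalemxAl.
have D (a b : 'I_N) : (texp (- X) *m delta_mx a b *m texp X) p q = texp (- X) p
  a * texp X b q.
  rewrite mxE (bigD1 b) //= mxE (bigD1 a) //= mxE !eqxx mulr1.
  rewrite big1 => [|k /negbTE ka]; last by rewrite mxE ka mulr0.
  rewrite addr0 big1 ?addr0 // => k /negbTE kb.
  by rewrite mxE big1 ?mul0r // => l _; rewrite mxE kb andbF mulr0.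
rewrite D mxE [X in _ - X]mxE D.
case: (boolP (is_TA t)) => [_|nA]; rewrite ?mul0r ?subr0 //.
rewrite [X in _ * (_ * X)]texp_upper ?mulr0 ?subr0 //.
move: urs qm; rewrite /upper (negbTE nA) /=.
by have := ltn_ord r; have := ltn_ord s; have := ltn_ord q; lia.
Qed.

Section Prescribed.
Variables (p q : 'I_N).
Hypotheses (upq : upper p q) (q_mid : is_TA t || (q <= rev_ord q)%N).
Variables a b : 'I_N -> K.

Definition hook : 'M[K]_N := \matrix_(r, s)
  if (r == p) && (p < s < q)%N then a s
  else if (s == q) && (p < r < q)%N then b r else 0.

(** Outside type A, the reflection makes the hook skew, hence an element of the
Lie algebra. *)
Definition hook_lie : 'M[K]_N := hook - (~~ is_TA t)%:R *: antitr hook.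

Lemma hook_strict : strictly_upper hook.
Proof.
move=> r s sr; rewrite mxE; case: eqP => [e|_] /=.
  case: ifP => [/andP[ps _]|_]; first by rewrite e leqNgt ps in sr.
  case: ifP => // /andP[_ /andP[]]; by rewrite e ltnn.
case: ifP => // /andP[/eqP e /andP[_]].
by rewrite -e ltnNge sr.
Qed.

Lemma hook_right (r s : 'I_N) : (q < s)%N -> hook r s = 0.
Proof.
move=> qs; rewrite mxE; case: ifP => [/andP[_ /andP[_ sq]]|_].
  by have := ltn_trans qs sq; rewrite ltnn.
by rewrite -val_eqE gtn_eqF.
Qed.

Lemma hook_lieD r s :
  hook_lie r s = hook r s - (~~ is_TA t)%:R * hook (rev_ord s) (rev_ord r).
Proof.
rewrite /hook_lie [LHS]mxE; congr (_ + _); rewrite [LHS]mxE; congr (- _).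
by rewrite [LHS]mxE [X in _ * X]mxE.
Qed.

Lemma hook_lie_mem : hook_lie \in L.
Proof.
apply/lie_algP; split=> [r s sr|nA].
  rewrite hook_lieD hook_strict // [hook _ _]hook_strict ?mulr0 ?subr0 //=.
  by rewrite leq_sub2l.
apply/matrixP => r s; rewrite [LHS]mxE [RHS]mxE !hook_lieD nA !rev_ordK !mul1r.
by rewrite opprB.
Qed.

(** The reflection of the hook lies to the right of column [q]. *)
Lemma hook_lieE (r s : 'I_N) : (s <= q)%N -> hook_lie r s = hook r s.
Proof.
move=> sq; rewrite hook_lieD; case: (boolP (is_TA t)) q_mid => [_ _|_ /= qq].
  by rewrite mul0r subr0.
suff -> : hook (rev_ord s) (rev_ord r) = 0 by rewrite mulr0 subr0.
case: (ltnP q (rev_ord r)) => [/hook_right->//|rq].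
apply: hook_strict => /=; rewrite (leq_trans rq) // (leq_trans qq) //=.
by rewrite leq_sub2l.
Qed.

(** A row strictly between [p] and [q] has, up to column [q], its only nonzero
entry in column [q]; the next factor would have to use a diagonal entry, or one
below the diagonal. *)
Lemma hook_lie_pow_col k (r : 'I_N) : (p < r < q)%N ->
  (hook_lie ^+ k.+2) r q = 0.
Proof.
move=> /andP[pr rq]; rewrite exprS [LHS]mxE big1 // => m _.
have HL := hook_lie_mem; have [Hu _] := (lie_algP _).1 HL.
case: (ltnP m q) => [mq|qm]; last by rewrite strictly_upper_pow ?mulr0 // addnS
  ltnS (leq_trans qm) ?leq_addr.
rewrite hook_lieE 1?ltnW // mxE -!val_eqE (gtn_eqF pr) (ltn_eqF mq) /=.
by rewrite mul0r.
Qed.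

(** Symmetric to [hook_lie_pow_col]: a column strictly between [p] and [q] only
meets the hook in row [p]. *)
Lemma hook_lie_pow_row k (s : 'I_N) : (p < s < q)%N ->
  (hook_lie ^+ k.+2) p s = 0.
Proof.
move=> /andP[ps sq]; rewrite exprSr [LHS]mxE big1 // => m _.
have HL := hook_lie_mem; have [Hu _] := (lie_algP _).1 HL.
case: (ltnP p m) => [pm|mp]; last by rewrite strictly_upper_pow ?mul0r // addnS
  ltnS (leq_trans mp) ?leq_addr.
rewrite [X in _ * X]hook_lieE 1?ltnW // mxE -!val_eqE (gtn_eqF pm) (ltn_eqF sq)
  /=.
by rewrite mulr0.
Qed.

Lemma texp_hook_col (r : 'I_N) : (p < r < q)%N -> texp hook_lie r q = b r.
Proof.
move=> prq; have /andP[pr rq] := prq; rewrite texpE big1 => [|k _]; last first.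
  by rewrite hook_lie_pow_col // mulr0.
rewrite hook_lieE // mxE -!val_eqE (ltn_eqF rq) (gtn_eqF pr) /= eqxx prq.
by rewrite add0r addr0.
Qed.

Lemma texp_hook_row (s : 'I_N) : (p < s < q)%N -> texp (- hook_lie) p s = - a s.
Proof.
move=> psq; have /andP[ps sq] := psq; rewrite texpE big1 => [|k _]; last first.
  suff -> : ((- hook_lie) ^+ k.+2) p s = 0 by rewrite mulr0.
  rewrite exprNn -signr_odd; case: (odd _).
    by rewrite expr1 mulN1r [LHS]mxE hook_lie_pow_row // oppr0.
  by rewrite expr0 mul1r hook_lie_pow_row.
rewrite [X in _ + X + _]mxE hook_lieE 1?ltnW // mxE eqxx psq -val_eqE (ltn_eqF
  ps).
by rewrite add0r addr0.
Qed.

End Prescribed.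
End Coadjoint.

(** * Elementary orbits *)

Section Orbit.
Variables (K : numFieldType) (t : lie_type) (n : nat).
Local Notation N := (mxdim t n).
Local Notation L := (lie_alg K t n).
Variables (p q : 'I_N).
Hypotheses (upq : upper p q) (q_mid : is_TA t || (q <= rev_ord q)%N).
Implicit Types r s : 'I_N.

(** The elementary orbit, with the analytic exponential replaced by [texp]; see
[elem_orbit_exp]. *)
Definition exp_orbit (f : lie_dual K t n) : Prop :=
  exists2 X, X \in L & f = coadj (texp X) (e_dual K t (root_at p q)).

Local Notation val f r s := (f (e_ (root_at r s))).

(** The general value is [u_r w_s], where [u] and [w] are themselves values:
[u_r] is the value at [(r, q)], since [w_q = 1], and [w_s] is the one at
[(p, s)], since [u_p = 1]. *)
Lemma orbit_values f r s : exp_orbit f -> upper r s ->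
  val f r s = if (p <= r)%N && (s <= q)%N then
     (if r == p then 1 else val f r q) * (if s == q then 1 else val f p s) else
       0.
Proof.
move=> [X XL ->] urs; have NL := oppr_lie_alg XL.
rewrite coadj_e //; case: (ltnP r p) => [rp|pr] /=.
  by rewrite texp_upper // mul0r.
case: (ltnP q s) => [qs|sq] /=; first by rewrite [X in _ * X]texp_upper //
  mulr0.
have [rs _] := andP urs; congr (_ * _).
  case: eqP => [->|/eqP nrp]; first by rewrite texp_diag.
  have pr' : (p < r)%N by rewrite ltn_neqAle eq_sym val_eqE nrp.
  have [_ u] := hook_upper upq q_mid pr' (leq_trans rs sq).
  by rewrite coadj_e // texp_diag // mulr1.
case: eqP => [->|/eqP nsq]; first by rewrite texp_diag.
have sq' : (s < q)%N by rewrite ltn_neqAle val_eqE nsq.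
have [u _] := hook_upper upq q_mid (leq_ltn_trans pr rs) sq'.
by rewrite coadj_e // texp_diag // mul1r.
Qed.

(** The sign comes from row [p] being read on [exp (- X)]. *)
Lemma orbit_prescribed (u w : 'I_N -> K) :
  exists2 f, exp_orbit f &
    forall r : 'I_N, (p < r < q)%N -> val f p r = w r /\ val f r q = u r.
Proof.
have XL := hook_lie_mem p q (fun r => - u r) w.
have NL := oppr_lie_alg XL.
eexists; first by exists (hook_lie p q (fun r => - u r) w).
move=> r prq; have /andP[pr rq] := prq.
have [v v'] := hook_upper upq q_mid pr rq.
rewrite !coadj_e // !texp_diag // mul1r mulr1.
by rewrite texp_hook_col // texp_hook_row // opprK.
Qed.

(** The equations of the theorem, indexed by positions instead of roots. *)
Definition orbit_eqs (f : lie_dual K t n) := forall r s, upper r s ->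
  ~~ on_hook p q r s ->
  [/\ r = p -> s = q -> val f r s = 1,
      (p < r)%N -> (s < q)%N -> val f r s = val f p s * val f r q
    & ~ (r = p /\ s = q) -> ~~ ((p < r)%N && (s < q)%N) -> val f r s = 0].

(** Some point [g] of the orbit agrees with [f] on the hook. As [g] satisfies
the equations too, and these express every other value through those on the
hook, [f = g]. *)
Lemma orbit_eqsP f : exp_orbit f <-> orbit_eqs f.
Proof.
have onlyif g : exp_orbit g -> orbit_eqs g.
  move=> gO r s urs; rewrite /on_hook negb_or !negb_and -!leqNgt => ns.
  have V := orbit_values gO urs; split=> [rp sq|pr sq|npq nin].
  - by rewrite V rp sq !leqnn !eqxx mulr1.
  - have /negbTE rp : r != p by rewrite -val_eqE gtn_eqF.
    have /negbTE sq' : s != q by rewrite -val_eqE ltn_eqF.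
    by rewrite V (ltnW pr) (ltnW sq) rp sq' mulrC.
  - rewrite V; case: ifP => // /andP[pr sq];
    have {}npq : ~ (r = p :> nat /\ s = q :> nat).
      by move=> [/ord_inj ? /ord_inj ?]; apply: npq.
    by move: nin ns; rewrite -!val_eqE /=; clear -npq pr sq; lia.
split; first exact: onlyif.
move=> fE; have [g gO gE] := orbit_prescribed (fun r => val f r q) (fun s =>
  val f p s).
suff -> : f = g by [].
have two : 2%:R != 0 :> K by rewrite pnatr_eq0.
apply: dual_ext => // r s urs; have [rs _] := andP urs.
have sE r' s' : upper r' s' -> on_hook p q r' s' -> val f r' s' = val g r' s'.
  move=> /andP[rs' _] /orP[]/andP[/eqP e lt]; rewrite e in rs' *.
    by have [] := gE s'; rewrite ?rs' ?lt // => ->.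
  by have [] := gE r'; rewrite ?rs' ?lt // => _ ->.
case: (boolP (on_hook p q r s)) => [/sE->//|ns].
have [f1 f2 f3] := fE r s urs ns; have [g1 g2 g3] := onlyif g gO r s urs ns.
case: (boolP ((p < r)%N && (s < q)%N)) => [/andP[pr sq]|nin].
  rewrite f2 // g2 //; congr (_ * _).
    by have [] := gE s; rewrite ?sq ?(ltn_trans pr rs) // => ->.
  by have [] := gE r; rewrite ?pr ?(ltn_trans rs sq) // => _ ->.
case: (boolP ((r == p) && (s == q))) => [/andP[/eqP ep /eqP eq]|npq].
  by rewrite f1 // g1.
have nE : ~ (r = p /\ s = q) by move=> [ep eq]; rewrite ep eq !eqxx in npq.
by rewrite f3 // g3.
Qed.

Hypothesis qn : (q <= n)%N.

(** Both parts of the theorem at once: the column [q] is before position [n] for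
[eps i - eps j], and is the middle one, of weight zero, for [eps i]. *)
Lemma orbitP f : exp_orbit f <->
  (forall b, b \in regular_roots t (root_at p q) ->
    [/\ b = root_at p q -> f (e_ b) = 1,
        forall r s : 'I_n, (p < r)%N -> (r < s)%N -> (s < q)%N ->
          b = eps r - eps s ->
          f (e_ b) = f (e_ (wt p - eps s)) * f (e_ (eps r - wt q))
      & b <> root_at p q ->
        ~ (exists r s : 'I_n,
             [/\ (p < r)%N, (r < s)%N, (s < q)%N & b = eps r - eps s]) ->
        f (e_ b) = 0]).
Proof.
rewrite orbit_eqsP; split=> [fE b|fE r s urs ns].
  rewrite mem_filter => /andP[nb /pos_rootP[r [s [urs eb]]]].
  rewrite eb in nb *.
  rewrite singular_on_hook // in nb; have [f1 f2 f3] := fE r s urs nb.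
  split=> [/(root_at_inj urs upq)[]//|r' s' pr rs sq e|ne nex].
    have [er es] : r = emb t r' /\ s = emb t s'.
      by apply: root_at_inj urs (upper_diff t rs) _; rewrite e /root_at !wt_emb.
    rewrite -!(wt_emb t) -er -es; apply: f2; by rewrite ?er ?es.
  apply: f3 => [[er es]|]; first by apply: ne; rewrite er es.
  apply/negP => /andP[pr sq]; have [rs _] := andP urs; apply: nex.
  have sn := leq_trans sq qn.
  exists (Ordinal (ltn_trans rs sn)), (Ordinal sn); split=> //.
  rewrite /root_at -!(wt_emb t); congr (wt _ - wt _); exact: ord_inj.
have breg : root_at r s \in regular_roots t (root_at p q).
  by rewrite mem_filter root_at_pos_root // singular_on_hook // ns.
have [rs _] := andP urs; have [f1 f2 f3] := fE _ breg; split=>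
  [er es|pr sq|ne nin].
- by apply: f1; rewrite er es.
- have sn := leq_trans sq qn; pose s' := Ordinal sn; pose r' :=
  Ordinal (ltn_trans rs sn).
  have er : emb t r' = r by apply: ord_inj.
  have es : emb t s' = s by apply: ord_inj.
  by have := f2 r' s' pr rs sq; rewrite -!(wt_emb t) er es => ->.
- apply: f3 => [/(root_at_inj urs upq)//|[r' [s' [pr rs' sq e]]]].
  have [er es] : r = emb t r' /\ s = emb t s'.
    by apply: root_at_inj urs (upper_diff t rs') _; rewrite e /root_at !wt_emb.
  by move: nin; rewrite er es /= pr sq.
Qed.

Lemma orbit_singular (v : 'rV[int]_n -> K) :
  exists2 f, exp_orbit f &
    forall b, b \in singular_roots t (root_at p q) -> f (e_ b) = v b.
Proof.
have [f fO fE] := orbit_prescribed (fun r => v (root_at r q)) (fun s =>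
  v (root_at p s)).
exists f => // b bs.
have /pos_rootP[r [s [urs eb]]] : b \in pos_roots t n by move: bs;
  rewrite mem_filter => /andP[].
rewrite eb singular_on_hook // in bs; rewrite eb.
have [rs _] := andP urs.
case/orP: bs => /andP[/eqP e lt]; rewrite e in rs *.
  by have [] := fE s; rewrite ?rs ?lt.
by have [] := fE r; rewrite ?rs ?lt.
Qed.

End Orbit.

Lemma mexp_lie_alg (R : realType) t n (X : 'M[R[i]]_(mxdim t n)) :
  X \in lie_alg R[i] t n -> mexp X = texp X.
Proof.
move=> XL; apply: mexp_nilpotent; apply: strictly_upper_nilpotent;
  last by rewrite leqW.
by case/lie_algP: XL.
Qed.

Lemma elem_orbit_exp (R : realType) t n (p q : 'I_(mxdim t n)) :
  elem_orbit R t (root_at p q) 1 = [set f | exp_orbit p q f].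
Proof.
rewrite /elem_orbit; apply/seteqP; split=> f /=.
  by move=> [h [X /= XL <-] <-]; exists X => //; rewrite scale1r mexp_lie_alg.
move=> [X XL ->]; exists (mexp X); first by exists X.
by rewrite scale1r mexp_lie_alg.
Qed.

Theorem theorem4p2 (R : realType) (n : nat) (n_gt0 : (0 < n)%N) :
  (forall (t : lie_type) (i j : 'I_n), (i < j)%N ->
     elem_orbit R t (eps i - eps j) 1
     = [set f : lie_dual R[i] t n |
         forall b, b \in regular_roots t (eps i - eps j) ->
           [/\ b = eps i - eps j -> f (e_ b) = 1,
               forall r s : 'I_n, (i < r)%N -> (r < s)%N -> (s < j)%N ->
                 b = eps r - eps s ->
                 f (e_ b) = f (e_ (eps i - eps s)) * f (e_ (eps r - eps j))
             & b <> eps i - eps j ->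
               ~ (exists r s : 'I_n,
                    [/\ (i < r)%N, (r < s)%N, (s < j)%N & b = eps r - eps s]) ->
               f (e_ b) = 0]]
     /\ (forall v : 'rV[int]_n -> R[i],
           exists2 f, elem_orbit R t (eps i - eps j) 1 f &
             forall b, b \in singular_roots t (eps i - eps j) ->
               f (e_ b) = v b))
  /\
  (forall i : 'I_n,
     elem_orbit R TB (eps i) 1
     = [set f : lie_dual R[i] TB n |
         forall b, b \in regular_roots TB (eps i) ->
           [/\ b = eps i -> f (e_ b) = 1,
               forall r s : 'I_n, (i < r)%N -> (r < s)%N ->
                 b = eps r - eps s ->
                 f (e_ b) = f (e_ (eps i - eps s)) * f (e_ (eps r))
             & b <> eps i ->
               ~ (exists r s : 'I_n,
                    [/\ (i < r)%N, (r < s)%N & b = eps r - eps s]) ->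
               f (e_ b) = 0]]
     /\ (forall v : 'rV[int]_n -> R[i],
           exists2 f, elem_orbit R TB (eps i) 1 f &
             forall b, b \in singular_roots TB (eps i) -> f (e_ b) = v b)).
Proof.
split=> [t i j ij|i].
  have u := upper_diff t ij.
  have m : is_TA t || (emb t j <= rev_ord (emb t j))%N.
    by have := mxdim_bounds t n; have := ltn_ord j; rewrite /=; lia.
  have e : eps i - eps j = root_at (emb t i) (emb t j) by rewrite /root_at
    !wt_emb.
  have jn : (emb t j <= n)%N by exact: ltnW (ltn_ord j).
  split; last by rewrite e elem_orbit_exp => v; exact: (orbit_singular u m v).
  apply/seteqP; split=> f /=.
    by rewrite e elem_orbit_exp => /(orbitP u m jn); rewrite !wt_emb.
  by move=> h; rewrite e elem_orbit_exp; apply/(orbitP u m jn);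
    rewrite !wt_emb -e.
(* The root [eps i] sits in the middle column, whose weight is zero. *)
have nN : (n < mxdim TB n)%N by rewrite /= ltnS -addnn leq_addr.
pose z : 'I_(mxdim TB n) := Ordinal nN.
have u : upper (emb TB i) z.
  by rewrite /upper /=; have := ltn_ord i; lia.
have m : is_TA TB || (z <= rev_ord z)%N by rewrite /=; lia.
have wz : wt z = 0 by apply: wt_mid.
have e : eps i = root_at (emb TB i) z by rewrite /root_at wt_emb wz subr0.
split; last by rewrite e elem_orbit_exp => v; exact: (orbit_singular u m v).
have O f : elem_orbit R TB (eps i) 1 f <-> exp_orbit (emb TB i) z f.
  by rewrite e elem_orbit_exp.
apply/seteqP; split=> f /=.
  move=> /O/(orbitP u m (leqnn n)); rewrite wt_emb wz -e => h b /h[h1 h2 h3].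
  split=> // [r s ir rs eb|ne nex].
    by rewrite (h2 r s ir rs (ltn_ord s) eb) subr0.
  by apply: h3 => // -[r [s [ir rs _ eb]]]; apply: nex; exists r, s.
move=> h; apply/O/(orbitP u m (leqnn n)); rewrite wt_emb wz -e =>
  b /h[h1 h2 h3].
split=> // [r s ir rs sn eb|ne nex].
  by rewrite (h2 r s ir rs eb) subr0.
by apply: h3 => // -[r [s [ir rs eb]]]; apply: nex; exists r, s; split=> //=.
Qed.
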